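(* Let $n\ge 3$ be an integer and let $K=\{123,132,231\}$. The number of equivalence classes of $S_n$ under $K$-equivalence is $2^{n-1}$.
   Context: Permutations in $S_n$ are written as words $\pi_1\pi_2\cdots\pi_n$ in one-line notation. The order permutation of a word $u$ of $c$ distinct positive integers is the unique $\sigma\in S_c$ with $\sigma_i<\sigma_j$ iff $u_i<u_j$. A replacement partition $K$ of $S_c$ is a set partition of $S_c$; it is denoted by listing its parts with the one-element parts (and outer brackets) omitted, so here $K$ is the set partition of $S_3$ whose only part of size greater than one is $\{123,132,231\}$. The $K$-equivalence on $S_n$ is the equivalence relation generated by: $\phi\equiv\psi$ whenever $\phi=aub$ and $\psi=avb$ (concatenations) for some possibly empty words $a,b$ and words $u,v$ of length $c$ (so $u,v$ occupy the same $c$ consecutive positions) such that the order permutations of $u$ and $v$ lie in the same part of $K$. All equivalence classes are counted, including one-element classes. *)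

(* Defs.v *)
From mathcomp Require Import all_boot all_fingroup.

Set Implicit Arguments.
Unset Strict Implicit.
Unset Printing Implicit Defensive.

(* 'S_n acts on {0, .., n-1}; the letters are shifted to be 1, .., n. *)
Definition one_line (n : nat) (s : 'S_n) : seq nat :=
  [seq (val (s i)).+1 | i <- enum 'I_n].

(* A word without repetition of size c has exactly one order permutation
   (order_perm_exists and order_perm_unique below). *)
Definition is_order_perm (c : nat) (u : seq nat) (s : 'S_c) : bool :=
  [&& size u == c, uniq u
    & [forall i : 'I_c, forall j : 'I_c,
         (s i < s j) == (nth 0 u i < nth 0 u j)]].

Definition same_part (c : nat) (K : {set {set 'S_c}}) (u v : seq nat) : bool :=
  [exists P in K, [exists s in P, is_order_perm u s]
                  && [exists t in P, is_order_perm v t]].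

(* Decidable form of "phi = a u b and psi = a v b", see replacementP. *)
Definition replacement (n c : nat) (K : {set {set 'S_c}}) : rel 'S_n :=
  [rel phi psi | [exists k : 'I_n.+1,
    [&& take k (one_line phi) == take k (one_line psi),
        drop (k + c) (one_line phi) == drop (k + c) (one_line psi)
      & same_part K (take c (drop k (one_line phi)))
                    (take c (drop k (one_line psi)))]]].

(* replacement is symmetric (replacement_sym), so its reflexive transitive closure is the
   equivalence relation it generates. *)
Definition K_equiv (n c : nat) (K : {set {set 'S_c}}) : rel 'S_n :=
  connect (replacement K).

Definition K_classes (n c : nat) (K : {set {set 'S_c}}) : {set {set 'S_n}} :=
  equivalence_partition (K_equiv K) [set: 'S_n].

Definition with_singletons (T : finType) (P : {set {set T}}) : {set {set T}} :=
  P :|: [set [set x] | x in ~: cover P].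

Definition K_123_132_231 : {set {set 'S_3}} :=
  with_singletons
    [set [set s : 'S_3 | one_line s \in
            [:: [:: 1; 2; 3]; [:: 1; 3; 2]; [:: 2; 3; 1]]]].

Lemma size_one_line (n : nat) (s : 'S_n) : size (one_line s) = n.
Proof. by rewrite size_map size_enum_ord. Qed.

Lemma uniq_one_line (n : nat) (s : 'S_n) : uniq (one_line s).
Proof.
rewrite map_inj_uniq ?enum_uniq // => i j [] /val_inj; exact: perm_inj.
Qed.

Lemma order_perm_unique (c : nat) (u : seq nat) (s t : 'S_c) :
  is_order_perm u s -> is_order_perm u t -> s = t.
Proof.
move=> /and3P[_ _ /'forall_forallP Hs] /and3P[_ _ /'forall_forallP Ht].
have rank (r : 'S_c) i : #|[set j | r j < r i]| = r i.
  have -> : [set j | r j < r i] = r @^-1: [set k : 'I_c | k < r i].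
    by apply/setP=> j; rewrite !inE.
  rewrite card_preimset; last exact: perm_inj.
  by rewrite -sum1dep_card (big_ord_narrow (ltnW (ltn_ord (r i)))) /=
     sum1_card card_ord.
apply/permP=> i; apply: val_inj; rewrite /= -(rank s) -(rank t).
by apply: eq_card => j; rewrite !inE (eqP (Hs j i)) (eqP (Ht j i)).
Qed.

Lemma order_perm_exists (c : nat) (u : seq nat) :
  size u = c -> uniq u -> exists s : 'S_c, is_order_perm u s.
Proof.
move=> szu Uu; pose w := sort leq u.
have Uw : uniq w by rewrite sort_uniq.
have inw (i : 'I_c) : nth 0 u i \in w by rewrite mem_sort mem_nth ?szu.
have ltw (i : 'I_c) : index (nth 0 u i) w < c.
  by rewrite -[X in _ < X]szu -(size_sort leq) index_mem.
have inj : injective (fun i => Ordinal (ltw i)).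
  move=> i j [] /(congr1 (nth 0 w)); rewrite !nth_index // => /eqP.
  by rewrite nth_uniq ?szu // => /eqP/val_inj.
exists (perm inj); rewrite /is_order_perm szu Uu eqxx /=.
apply/'forall_forallP=> i j; rewrite !permE /=.
have sw : sorted ltn w.
  by rewrite ltn_sorted_uniq_leq Uw sort_sorted //; exact: leq_total.
have homo := sorted_ltn_index ltn_trans sw.
apply/eqP; apply/idP/idP; first exact: homo.
apply: contraLR; rewrite -!leqNgt leq_eqVlt => /predU1P[|lt_ji].
  by move/(congr1 (nth 0 w)); rewrite !nth_index // => ->.
by rewrite ltnW // homo.
Qed.

Lemma replacementP (n c : nat) (K : {set {set 'S_c}}) (phi psi : 'S_n) :
  reflect (exists a u v b : seq nat,
             [/\ one_line phi = a ++ u ++ b, one_line psi = a ++ v ++ b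
               & same_part K u v])
          (replacement K phi psi).
Proof.
apply: (iffP existsP) => [[k /and3P[/eqP ea /eqP eb uv]]|].
  exists (take k (one_line phi)), (take c (drop k (one_line phi))),
    (take c (drop k (one_line psi))), (drop (k + c) (one_line phi)).
  split=> //; first by rewrite addnC -drop_drop !cat_take_drop.
  by rewrite ea eb addnC -drop_drop !cat_take_drop.
case=> a [u] [v] [b] [ephi epsi uv].
have [szu szv] : size u = c /\ size v = c.
  case/exists_inP: uv => P _ /andP[/exists_inP[s _ /and3P[/eqP ? _ _]]].
  by case/exists_inP=> t _ /and3P[/eqP ? _ _].
have ltan : size a < n.+1.
  by rewrite ltnS -(size_one_line phi) ephi size_cat leq_addr.
exists (Ordinal ltan); rewrite /= ephi epsi !take_size_cat // eqxx /=.
rewrite addnC -!drop_drop !drop_size_cat // eqxx /=.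
by rewrite !take_size_cat.
Qed.

Lemma replacement_sym (n c : nat) (K : {set {set 'S_c}}) :
  symmetric (@replacement n c K).
Proof.
move=> phi psi; apply: eq_existsb => k.
rewrite (eq_sym (take _ _)) (eq_sym (drop _ _)); congr [&& _, _ & _].
by apply: eq_existsb => P; congr (_ && _); rewrite andbC.
Qed.

Lemma K_equivP (n c : nat) (K : {set {set 'S_c}}) :
  equivalence_rel (@K_equiv n c K).
Proof.
have sK : connect_sym (@replacement n c K).
  exact/sym_connect_sym/replacement_sym.
move=> x y z; split=> [|xy]; first exact: connect0.
exact: same_connect.
Qed.

Lemma with_singletons_partition (T : finType) (P : {set {set T}}) :
  trivIset P -> set0 \notin P -> partition (with_singletons P) [set: T].
Proof.
move=> tP P0; apply/and3P; split.
- rewrite eqEsubset subsetT; apply/subsetP=> x _.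
  have [/bigcupP[A PA xA]|xP] := boolP (x \in cover P); apply/bigcupP.
    by exists A; rewrite // inE PA.
  by exists [set x]; rewrite ?set11 // inE imset_f ?orbT // inE.
- apply/trivIsetP=> A B.
  have dj C x : C \in P -> x \in ~: cover P -> [disjoint C & [set x]].
    move=> PC; rewrite inE disjoint_sym disjoints1; apply: contra => xC.
    by apply/bigcupP; exists C.
  rewrite !inE => /orP[PA|/imsetP[x xP ->]] /orP[PB|/imsetP[y yP ->]] AB.
  + exact: (trivIsetP tP).
  + exact: dj.
  + by rewrite disjoint_sym; exact: dj.
  + by rewrite disjoints1 inE; apply: contra AB => /eqP->.
- rewrite inE negb_or P0; apply/imsetP=> -[x _ /setP/(_ x)].
  by rewrite !inE eqxx.
Qed.

Lemma K_123_132_231_partition : partition K_123_132_231 [set: 'S_3].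
Proof.
apply: with_singletons_partition.
  by apply/trivIsetP=> A B /set1P-> /set1P->; rewrite eqxx.
rewrite inE eq_sym; apply/set0Pn; exists 1%g.
rewrite inE /one_line (eq_map (g := fun i : 'I_3 => (val i).+1)).
  by rewrite (map_comp succn val) val_enum_ord.
by move=> i; rewrite perm1.
Qed.

(* Main.v *)
Require Import Defs.
From mathcomp Require Import all_boot all_fingroup.
From mathcomp Require Import zify.

(** In a word, let [k] be the smallest letter and [w = A k B].  As the smallest
    letter of each window that contains it, [k] can be exchanged across two
    letters: [k x y], [k y x] and [x y k] are equivalent when [x < y].  So the
    parity of the number of letters after [k] does not change when the window
    contains [k], nor in any other replacement.  Pushing [k] to the right sorts
    the letters of [B] two by two, until [k] is last or last but one: with
    [extract k w = A (sort_pairs B)], the word [w] is equivalent to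
    [insert_min b k (extract k w)], where [b] is that parity
    ([weq_insert_extract]).

    The class of [w] thus determines [b], and it also determines the class of
    the shorter word [extract k w] ([weq_extract]).  The only replacements for
    which this is not immediate are those inside [B]; such a window meets at
    most two of the pairs of [B], and the six words [p q r s] with [p < q] and
    [r < s] on four given letters are all equivalent ([weq_four]).  Conversely
    [b] and the class of [extract k w] determine the class of [w], since
    equivalent words stay equivalent when [k] is inserted in the last or last
    but one position ([weq_insert_min]).  Finally every bit together with every
    word on the remaining letters is obtained.

    Hence each letter but the largest contributes one free bit: the resulting
    [code] of [n - 1] bits is a complete invariant ([weq_code], [code_weq]), and
    all [2 ^ (n - 1)] values occur ([code_surj]). *)

Set Implicit Arguments.
Unset Strict Implicit.
Unset Printing Implicit Defensive.

(** * Equivalence of words *)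

(** The equivalence of words over [nat] generated by replacing three
    consecutive letters in the order 123 by the same letters in the order 132
    or 231; the replacement of 132 by 231 follows. *)
Inductive weq : seq nat -> seq nat -> Prop :=
| weq_refl w : weq w w
| weq_sym v w : weq v w -> weq w v
| weq_trans u v w : weq u v -> weq v w -> weq u w
| weq_132 a b x y z : x < y -> y < z ->
    weq (a ++ [:: x; y; z] ++ b) (a ++ [:: x; z; y] ++ b)
| weq_231 a b x y z : x < y -> y < z ->
    weq (a ++ [:: x; y; z] ++ b) (a ++ [:: y; z; x] ++ b).

Lemma weq_perm v w : weq v w -> perm_eq v w.
Proof.
elim=> [u|u u' _|u u' u'' _ uu' _|a b x y z _ _|a b x y z _ _] //.
- by rewrite perm_sym.
- exact: perm_trans.
- by rewrite perm_cat2l perm_cat2r perm_cons (perm_catC [:: y] [:: z]).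
- by rewrite perm_cat2l perm_cat2r (perm_catC [:: x] [:: y; z]).
Qed.

Lemma weq_cat a b v w : weq v w -> weq (a ++ v ++ b) (a ++ w ++ b).
Proof.
elim=> [u|u u' _|u u' u'' _ uu' _|a' b' x y z xy yz|a' b' x y z xy yz].
- exact: weq_refl.
- exact: weq_sym.
- exact: weq_trans.
- by rewrite -!(catA a') -!(catA _ b') !(catA a); exact: weq_132.
- by rewrite -!(catA a') -!(catA _ b') !(catA a); exact: weq_231.
Qed.

Lemma weq_catl a v w : weq v w -> weq (a ++ v) (a ++ w).
Proof. by move=> vw; rewrite -(cats0 v) -(cats0 w); exact: weq_cat. Qed.

Lemma weq_catr b v w : weq v w -> weq (v ++ b) (w ++ b).
Proof. exact: (@weq_cat [::]). Qed.

(** * Sorting a word two letters at a time *)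

(** Puts the letters in positions 1 and 2, 3 and 4, ... in increasing order; the
    last letter of a word of odd size is left alone. *)
Fixpoint sort_pairs (s : seq nat) : seq nat :=
  if s is x :: y :: s' then minn x y :: maxn x y :: sort_pairs s' else s.

(** Induction on words matching the recursion of [sort_pairs]. *)
Lemma pair_ind (T : Type) (P : seq T -> Prop) :
  P [::] -> (forall x, P [:: x]) ->
  (forall x y s, P s -> P (x :: y :: s)) -> forall s, P s.
Proof.
move=> P0 P1 P2 s; suff: P s /\ forall x, P (x :: s) by case.
by elim: s => [|y s [Ps Pys]]; split=> // x; apply: P2.
Qed.

Lemma perm_sort_pairs s : perm_eq (sort_pairs s) s.
Proof.
elim/pair_ind: s => //= x y s IH.
have [_|_] := leqP x y; first by rewrite !perm_cons.
by rewrite (perm_catCA [:: y] [:: x] _) /= !perm_cons.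
Qed.

(** On four letters, all words made of two increasing pairs are equivalent. *)
Lemma weq_four a b c d w : a < b -> b < c -> c < d ->
  w \in [:: [:: a; b; c; d]; [:: a; c; b; d]; [:: a; d; b; c];
            [:: b; c; a; d]; [:: b; d; a; c]; [:: c; d; a; b]] ->
  weq [:: a; b; c; d] w.
Proof.
move=> ab bc cd.
have [ac bd] := (ltn_trans ab bc, ltn_trans bc cd).
have abdc : weq [:: a; b; c; d] [:: a; b; d; c] by exact: (@weq_132 [:: a] [::]).
have acdb : weq [:: a; b; c; d] [:: a; c; d; b] by exact: (@weq_231 [:: a] [::]).
rewrite !inE => /or4P[|||/or3P[]] /eqP->.
- exact: weq_refl.
- exact: (@weq_132 [::] [:: d]).
- by apply: weq_trans abdc _; exact: (@weq_132 [::] [:: c]).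
- exact: (@weq_231 [::] [:: d]).
- by apply: weq_trans abdc _; exact: (@weq_231 [::] [:: c]).
- by apply: weq_trans acdb _; exact: (@weq_231 [::] [:: b]).
Qed.

(** The same fact stated from two increasing pairs [x < y] and [z < t] whose
    relative order is unknown; [v] is the increasing word on their letters. *)
Lemma weq_four_sort v x y z t : sorted leq v -> perm_eq v [:: x; y; z; t] ->
  uniq [:: x; y; z; t] -> x < y -> z < t -> weq v [:: x; y; z; t].
Proof.
move=> sv pv U xy zt.
have H a b c d : [&& a < b, b < c, c < d & [:: x; y; z; t] \in
       [:: [:: a; b; c; d]; [:: a; c; b; d]; [:: a; d; b; c];
            [:: b; c; a; d]; [:: b; d; a; c]; [:: c; d; a; b]]] ->
    weq v [:: x; y; z; t].
  case/and4P=> ab bc cd w4; have E := weq_four ab bc cd w4.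
  suff -> : v = [:: a; b; c; d] by [].
  apply: (sorted_eq leq_trans anti_leq) => //.
    by rewrite /sorted /path (ltnW ab) (ltnW bc) (ltnW cd).
  by rewrite (permPl pv) perm_sym weq_perm.
move: U; rewrite /= !inE !negb_or -!andbA => /and5P[_ xz xt yz /and3P[yt _ _]].
have [xz'|zx|] := ltngtP x z; last by move=> e; rewrite e eqxx in xz.
  have [yz'|zy|] := ltngtP y z; last by move=> e; rewrite e eqxx in yz.
    by apply: (H x y z t); rewrite xy yz' zt !inE eqxx.
  have [yt'|ty|] := ltngtP y t; last by move=> e; rewrite e eqxx in yt.
    by apply: (H x z y t); rewrite xz' zy yt' !inE eqxx !orbT.
  by apply: (H x z t y); rewrite xz' zt ty !inE eqxx !orbT.
have [xt'|tx|] := ltngtP x t; last by move=> e; rewrite e eqxx in xt.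
  have [yt'|ty|] := ltngtP y t; last by move=> e; rewrite e eqxx in yt.
    by apply: (H z x y t); rewrite zx xy yt' !inE eqxx !orbT.
  by apply: (H z x t y); rewrite zx xt' ty !inE eqxx !orbT.
by apply: (H z t x y); rewrite zt tx xy !inE eqxx !orbT.
Qed.

Lemma weq_sort_pairs_perm4 x y z t x' y' z' t' :
  uniq [:: x; y; z; t] -> perm_eq [:: x; y; z; t] [:: x'; y'; z'; t'] ->
  weq (sort_pairs [:: x; y; z; t]) (sort_pairs [:: x'; y'; z'; t']).
Proof.
have H v a b c d : sorted leq v -> perm_eq v [:: a; b; c; d] ->
    uniq [:: a; b; c; d] -> weq v (sort_pairs [:: a; b; c; d]).
  have p := perm_sort_pairs [:: a; b; c; d].
  (* By [p], the hypotheses on [a b c d] also hold for its sorted pairs. *)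
  rewrite -(permPr p) -(perm_uniq p) => sv pv U.
  by apply: weq_four_sort => //; move: U; rewrite /= !inE; lia.
move=> U p; have U' : uniq [:: x'; y'; z'; t'] by rewrite -(perm_uniq p).
have [v sv pv] : exists2 v, sorted leq v & perm_eq v [:: x; y; z; t].
  move: [:: x; y; z; t] => w; exists (sort leq w); last by rewrite perm_sort.
  exact: (sort_sorted leq_total).
apply: weq_trans (weq_sym (H v _ _ _ _ sv pv U)) (H v _ _ _ _ sv _ U').
exact: perm_trans pv p.
Qed.

(** A replacement in a word becomes an equivalence after sorting the pairs.  If
    the window starts with a pair and ends the word, the replacement survives
    as such; otherwise the window lies in two consecutive pairs. *)
Lemma weq_sort_pairs_step a b x y z u : x < y -> y < z ->
  (u = [:: x; z; y] \/ u = [:: y; z; x]) -> uniq (a ++ [:: x; y; z] ++ b) ->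
  weq (sort_pairs (a ++ [:: x; y; z] ++ b)) (sort_pairs (a ++ u ++ b)).
Proof.
move=> xy yz ueq.
have pu : perm_eq [:: x; y; z] u.
  case: ueq => ->; last by rewrite (perm_catC [:: x] [:: y; z]).
  by rewrite perm_cons (perm_catC [:: y] [:: z]).
elim/pair_ind: a => [|p|p q a IH] U.
- case: b U => [_|t b U].
    case: ueq => ->.
      rewrite /= (minn_idPl (ltnW xy)) (maxn_idPr (ltnW xy)).
      rewrite (minn_idPl (ltnW (ltn_trans xy yz))).
      rewrite (maxn_idPr (ltnW (ltn_trans xy yz))).
      exact: (@weq_132 [::] [::]).
    rewrite /= (minn_idPl (ltnW xy)) (maxn_idPr (ltnW xy)).
    rewrite (minn_idPl (ltnW yz)) (maxn_idPr (ltnW yz)).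
    exact: (@weq_231 [::] [::]).
  have U4 : uniq [:: x; y; z; t].
    by move: U; rewrite (cat_uniq [:: x; y; z; t] b) => /andP[].
  have p4 : perm_eq [:: x; y; z; t] (u ++ [:: t]).
    by rewrite (perm_cat2r [:: t] [:: x; y; z] u).
  case: ueq p4 => -> p4;
  exact: (weq_catr (sort_pairs b) (weq_sort_pairs_perm4 U4 p4)).
- have U4 : uniq [:: p; x; y; z].
    by move: U; rewrite (cat_uniq [:: p; x; y; z] b) => /andP[].
  have p4 : perm_eq [:: p; x; y; z] (p :: u) by rewrite perm_cons.
  case: ueq p4 => -> p4;
  exact: (weq_catr (sort_pairs b) (weq_sort_pairs_perm4 U4 p4)).
- have {}IH := IH _; apply: (weq_catl [:: minn p q; maxn p q]); apply: IH.
  by move: U; rewrite /= => /and3P[].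
Qed.

(** * Extracting the smallest letter *)

(** The letters of [w] after the first occurrence of [k]. *)
Definition after (k : nat) (w : seq nat) : seq nat := drop (index k w).+1 w.

(** The word left before [k] when [k] has been pushed to the right as far as
    possible, followed by the last letter if [k] stops before it; meaningful
    when [k] is the smallest letter of [w]. *)
Definition extract (k : nat) (w : seq nat) : seq nat :=
  take (index k w) w ++ sort_pairs (after k w).

Lemma after_cat k A B : k \notin A -> after k (A ++ k :: B) = B.
Proof.
move=> kA; rewrite /after index_cat (negbTE kA) /= eqxx addn0.
by rewrite -cat_rcons drop_size_cat ?size_rcons.
Qed.

Lemma extract_cat k A B : k \notin A ->
  extract k (A ++ k :: B) = A ++ sort_pairs B.
Proof.
move=> kA; rewrite /extract after_cat // index_cat (negbTE kA) /= eqxx addn0.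
by rewrite take_size_cat.
Qed.

Lemma split_first_occurrence (T : eqType) (k : T) w : k \in w ->
  exists A B, w = A ++ k :: B /\ k \notin A.
Proof.
move=> kw; exists (take (index k w) w), (drop (index k w).+1 w).
split; last by rewrite in_take_leq ?index_size // ltnn.
have := drop_nth k (etrans (index_mem k w) kw); rewrite nth_index // => <-.
by rewrite cat_take_drop.
Qed.

Lemma perm_extract k w : k \in w -> perm_eq w (k :: extract k w).
Proof.
case/split_first_occurrence=> A [B [-> kA]]; rewrite extract_cat //.
by rewrite (perm_catCA A [:: k] B) perm_cons perm_cat2l perm_sym perm_sort_pairs.
Qed.

(** The cases are: the window after [k], at [k], or before [k].  A window that
    contains [k] has it as its smallest letter [x]. *)
Lemma extract_step k a b x y z u : x < y -> y < z ->
  (u = [:: x; z; y] \/ u = [:: y; z; x]) ->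
  let w := a ++ [:: x; y; z] ++ b in let w' := a ++ u ++ b in
  uniq w -> k \in w -> all (leq k) w ->
  weq (extract k w) (extract k w') /\
  odd (size (after k w)) = odd (size (after k w')).
Proof.
move=> xy yz ueq w w' U kw kmin.
have szu : size u = 3 by case: ueq => ->.
have memu : u =i [:: x; y; z].
  case: ueq => -> i; rewrite !inE;
  by case: (i == x); case: (i == y); case: (i == z).
have [ka|ka] := boolP (k \in a).
  have [A [B [aE kA]]] := split_first_occurrence ka.
  rewrite /w /w' aE -!catA /= !extract_cat // !after_cat //; split.
    apply: weq_catl; apply: weq_sort_pairs_step => //.
    by move: U; rewrite /w aE -catA cat_uniq /= => /and4P[].
  by rewrite !size_cat szu.
have kx : k <= x by apply: (allP kmin); rewrite !mem_cat inE eqxx orbT.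
have [kxE|k'x] := eqVneq k x.
  subst k; rewrite /w /w' /= extract_cat // after_cat //.
  have xz := ltn_trans xy yz.
  case: ueq => ->.
    rewrite extract_cat // after_cat //; split=> //=.
    by rewrite minnC maxnC; exact: weq_refl.
  rewrite (catA a [:: y; z]) extract_cat ?after_cat /=; last first.
  - by rewrite mem_cat !inE; apply/norP; split=> //; lia.
  - by rewrite mem_cat !inE; apply/norP; split=> //; lia.
  rewrite (minn_idPl (ltnW yz)) (maxn_idPr (ltnW yz)) -catA negbK.
  by split=> //; exact: weq_refl.
have kxyz : k \notin [:: x; y; z] by rewrite !inE; lia.
have kb : k \in b by move: kw; rewrite !mem_cat (negbTE ka) (negbTE kxyz).
have [A [B [bE kA]]] := split_first_occurrence kb.
have E v : v =i [:: x; y; z] -> k \notin a ++ v ++ A.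
  by move=> mv; rewrite !mem_cat mv (negbTE ka) (negbTE kxyz).
have cE v : a ++ v ++ b = (a ++ v ++ A) ++ k :: B by rewrite bE -!catA.
rewrite /w /w' !cE !extract_cat ?after_cat ?E //; split=> //.
apply: weq_catr; apply: weq_cat.
by case: ueq => ->; [exact: (@weq_132 [::] [::])|exact: (@weq_231 [::] [::])].
Qed.

(** The parity of the number of letters after the minimum, and the class of the
    extracted word, are invariants of the class of [v]. *)
Lemma weq_extract k v w : weq v w -> uniq v -> k \in v -> all (leq k) v ->
  weq (extract k v) (extract k w) /\
  odd (size (after k v)) = odd (size (after k w)).
Proof.
elim=> {v w} [w|v w vw IH|u v w uv IHu vw IHv|a b x y z xy yz|a b x y z xy yz].
- by split=> //; exact: weq_refl.
- have p := weq_perm vw; rewrite -(perm_uniq p) -(perm_mem p) -(perm_all _ p).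
  by move=> U kv /(IH U kv)[? ->]; split=> //; exact: weq_sym.
- have p := weq_perm uv => U ku kmin.
  have [e1 ->] := IHu U ku kmin.
  rewrite (perm_uniq p) in U; rewrite (perm_mem p) in ku.
  rewrite (perm_all _ p) in kmin.
  by have [e2 ->] := IHv U ku kmin; split=> //; exact: weq_trans e2.
- by apply: extract_step => //; left.
- by apply: extract_step => //; right.
Qed.

(** * Inserting the smallest letter *)

(** Inserts [k] at the end of [s] if [b] is false, just before the last letter
    of [s] if [b] is true.  The boolean [b] is used as the number of letters
    left after [k]; for empty [s] both cases give the one-letter word [k]. *)
Definition insert_min (b : bool) (k : nat) (s : seq nat) : seq nat :=
  take (size s - b) s ++ k :: drop (size s - b) s.

Lemma insert_min_cat (b : bool) k A s : b <= size s ->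
  insert_min b k (A ++ s) = A ++ insert_min b k s.
Proof.
move=> bs; rewrite /insert_min size_cat -addnBA //.
by rewrite take_cat drop_cat ltnNge leq_addr /= addKn catA.
Qed.

Lemma weq_push_min k s : all (ltn k) s -> uniq s ->
  weq (k :: s) (insert_min (odd (size s)) k (sort_pairs s)).
Proof.
elim/pair_ind: s => [_ _|x _ _|x y s IH /= /and3P[kx ky ks]]; try exact: weq_refl.
rewrite inE negb_or -andbA => /and4P[xy _ _ U]; rewrite negbK.
have szs : size (sort_pairs s) = size s by rewrite (perm_size (perm_sort_pairs s)).
rewrite (@insert_min_cat _ _ [:: minn x y; maxn x y]); last first.
  by rewrite szs; case: (s) => //= ? ?; case: (odd _).
apply: weq_trans (weq_catl [:: minn x y; maxn x y] (IH ks U)).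
have [xy'|yx|e] := ltngtP x y; last by rewrite e eqxx in xy.
  exact: (@weq_231 [::] s).
apply: weq_trans (weq_sym _) (@weq_231 [::] s k y x ky yx).
exact: (@weq_132 [::] s).
Qed.

Lemma weq_insert_extract k w : uniq w -> k \in w -> all (leq k) w ->
  weq w (insert_min (odd (size (after k w))) k (extract k w)).
Proof.
move=> U kw kmin; have [A [B [wE kA]]] := split_first_occurrence kw.
rewrite wE extract_cat // after_cat // insert_min_cat; last first.
  rewrite (perm_size (perm_sort_pairs B)).
  by case: (B) => //= ? ?; case: (odd _).
move: U kmin; rewrite wE cat_uniq all_cat /= => /and4P[_ _ kB UB].
case/and3P=> _ _ kminB; apply/weq_catl/weq_push_min => //.
apply/allP=> i iB /=; rewrite ltn_neqAle (allP kminB) // andbT.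
by apply: contra kB => /eqP->.
Qed.

(** The delicate case is a window at the end of the word, which the insertion of
    [k] breaks: pulling [k] to its front turns [x y k z] into [k x y z] and
    makes the window contiguous again. *)
Lemma insert_min_step k a b x y z u : k < x -> x < y -> y < z ->
  (u = [:: x; z; y] \/ u = [:: y; z; x]) ->
  weq (insert_min true k (a ++ [:: x; y; z] ++ b))
      (insert_min true k (a ++ u ++ b)).
Proof.
move=> kx xy yz ueq; have szu : size u = 3 by case: ueq => ->.
rewrite !(@insert_min_cat _ _ a) ?size_cat ?szu //; apply: weq_catl.
have [ky kz xz] : [/\ k < y, k < z & x < z] by split; lia.
case: b => [|l b]; last first.
  rewrite !insert_min_cat //; apply: weq_catr.
  by case: ueq => ->; [exact: (@weq_132 [::] [::])|exact: (@weq_231 [::] [::])].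
have pull p q r : k < p -> p < q -> weq [:: p; q; k; r] [:: k; p; q; r].
  by move=> kp pq; apply/weq_sym; exact: (@weq_231 [::] [:: r]).
apply: weq_trans (pull x y z kx xy) _.
case: ueq => -> /=.
  apply: weq_trans (weq_sym (pull x z y kx xz)).
  exact: (@weq_132 [:: k] [::]).
apply: weq_trans (weq_sym (pull y z x ky yz)).
exact: (@weq_231 [:: k] [::]).
Qed.

Lemma weq_insert_min c k s t : weq s t -> all (ltn k) s ->
  weq (insert_min c k s) (insert_min c k t).
Proof.
case: c => st ks; last first.
  rewrite /insert_min !subn0 !take_size !drop_size; exact: weq_catr.
elim: st ks => {s t} [w|v w vw IH|u v w uv IHu vw IHv
  |a b x y z xy yz|a b x y z xy yz].
- by move=> _; exact: weq_refl.
- by rewrite -(perm_all _ (weq_perm vw)) => /IH; exact: weq_sym.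
- move=> ku; apply: weq_trans (IHu ku) (IHv _).
  by rewrite -(perm_all _ (weq_perm uv)).
- by rewrite all_cat => /and3P[_ kx _]; apply: insert_min_step => //; left.
- by rewrite all_cat => /and3P[_ kx _]; apply: insert_min_step => //; right.
Qed.

(** * A complete invariant *)

(** The invariant of a word [w] on the letters [k], ..., [k + m]: the parity of
    the number of letters after [k], followed by the invariant of the extracted
    word, whose letters are [k + 1], ..., [k + m].  A word with one letter has
    the empty code. *)
Fixpoint code (m k : nat) (w : seq nat) : seq bool :=
  if m is m'.+1 then odd (size (after k w)) :: code m' k.+1 (extract k w)
  else [::].

Lemma size_code m k w : size (code m k w) = m.
Proof. by elim: m k w => //= m IH k w; rewrite IH. Qed.

Lemma perm_iota_min k m w : perm_eq w (iota k m.+1) ->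
  [/\ uniq w, k \in w, all (leq k) w & perm_eq (extract k w) (iota k.+1 m)].
Proof.
move=> p; have kw : k \in w.
  by rewrite (perm_mem p) mem_iota leqnn addnS ltnS leq_addr.
split=> //.
- by rewrite (perm_uniq p) iota_uniq.
- by rewrite (perm_all _ p); apply/allP=> i; rewrite mem_iota => /andP[].
- by rewrite -(perm_cons k) -(permPl (perm_extract kw)).
Qed.

Lemma weq_code m k v w : perm_eq v (iota k m.+1) -> weq v w ->
  code m k v = code m k w.
Proof.
elim: m k v w => // m IH k v w pv vw.
have [U kv kmin pe] := perm_iota_min pv.
have [e eb] := weq_extract vw U kv kmin.
by rewrite /= eb (IH _ _ _ pe e).
Qed.

Lemma code_weq m k v w :
  perm_eq v (iota k m.+1) -> perm_eq w (iota k m.+1) ->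
  code m k v = code m k w -> weq v w.
Proof.
elim: m k v w => [|m IH] k v w pv pw.
  move=> _; rewrite (perm_small_eq _ pv) // (perm_small_eq _ pw) //.
  exact: weq_refl.
have [Uv kv kminv pev] := perm_iota_min pv.
have [Uw kw kminw pew] := perm_iota_min pw.
move=> /= [eb /(IH _ _ _ pev pew) vw].
apply: weq_trans (weq_insert_extract Uv kv kminv) _.
apply: weq_trans _ (weq_sym (weq_insert_extract Uw kw kminw)).
rewrite eb; apply: weq_insert_min => //.
by rewrite (perm_all _ pev); apply/allP=> i; rewrite mem_iota => /andP[].
Qed.

Lemma code_surj m k c : size c = m ->
  exists2 w, perm_eq w (iota k m.+1) & code m k w = c.
Proof.
elim: m k c => [|m IH] k [|b c] // szc; first by exists [:: k].
case: szc => szc; case: (IH k.+1 c szc) => s ps <-.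
have szs : size s = m.+1 by rewrite (perm_size ps) size_iota.
have kt : k \notin take (size s - b) s.
  by apply/negP=> /mem_take; rewrite (perm_mem ps) mem_iota ltnn.
exists (insert_min b k s).
  rewrite /insert_min (perm_catCA _ [:: k] _) /= cat_take_drop.
  by rewrite perm_cons.
rewrite /= /insert_min after_cat // extract_cat // size_drop szs.
rewrite (_ : m.+1 - (m.+1 - b) = b); last by case: (b); lia.
have sp1 : sort_pairs (drop (m.+1 - b) s) = drop (m.+1 - b) s.
  have: size (drop (m.+1 - b) s) <= 1 by rewrite size_drop szs; case: (b); lia.
  by case: (drop _ _) => [|? []].
by rewrite sp1 cat_take_drop oddb.
Qed.

(** * From permutations to words *)

Lemma perm_one_line n (s : 'S_n) : perm_eq (one_line s) (iota 1 n).
Proof.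
apply: uniq_perm; rewrite ?uniq_one_line ?iota_uniq // => i.
apply/mapP/idP => [[j _ ->]|]; first by rewrite mem_iota /= add1n ltnS ltn_ord.
rewrite mem_iota add1n => /andP[i0 iN].
have iN' : i.-1 < n by lia.
exists (s^-1%g (Ordinal iN')); first exact: mem_enum.
by rewrite permKV /= prednK.
Qed.

Lemma one_line_surj n w : perm_eq w (iota 1 n) -> exists s : 'S_n, one_line s = w.
Proof.
move=> p; have szw : size w = n by rewrite (perm_size p) size_iota.
have Uw : uniq w by rewrite (perm_uniq p) iota_uniq.
have memw (i : 'I_n) : 0 < nth 0 w i <= n.
  have : nth 0 w i \in iota 1 n by rewrite -(perm_mem p) mem_nth // szw.
  by rewrite mem_iota add1n ltnS.
have ltw (i : 'I_n) : (nth 0 w i).-1 < n by have := memw i; lia.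
have inj : injective (fun i => Ordinal (ltw i)).
  move=> i j [] e; apply/val_inj/(uniqP 0 Uw); rewrite ?inE ?szw ?ltn_ord //=.
  by have := memw i; have := memw j; lia.
exists (perm inj); apply: (@eq_from_nth _ 0); rewrite size_one_line ?szw // => i iN.
rewrite (nth_map (Ordinal iN)) ?size_enum_ord // permE /= nth_enum_ord //.
by have := memw (Ordinal iN) => /=; lia.
Qed.

(** The letter in position [i] of a word with order permutation [s] is the
    letter of rank [s i]; ranks start at 0, but the letters of [one_line s] start
    at 1, hence the predecessor. *)
Lemma order_perm_sort c u (s : 'S_c) : is_order_perm u s ->
  u = [seq nth 0 (sort leq u) j.-1 | j <- one_line s].
Proof.
case/and3P=> /eqP szu Uu /'forall_forallP Hs.
pose t := [seq nth 0 u (s^-1%g i) | i <- enum 'I_c].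
have pt : perm_eq t u.
  have -> : t = [seq nth 0 u (val i) | i <- [seq s^-1%g i | i <- enum 'I_c]].
    by rewrite -map_comp.
  have {2}-> : u = [seq nth 0 u (val i) | i <- enum 'I_c].
    by rewrite (map_comp (nth 0 u) val) val_enum_ord -szu map_nth_iota0 ?take_size.
  apply: perm_map; apply: uniq_perm; rewrite ?enum_uniq //.
    by rewrite map_inj_uniq ?enum_uniq //; exact: perm_inj.
  move=> i; rewrite mem_enum; apply/mapP; exists (s i); rewrite ?mem_enum //.
  by rewrite permK.
have st : sorted leq t.
  rewrite sorted_map; apply: (@sub_sorted _ (fun i j : 'I_c => i < j)).
    move=> i j ij; apply: ltnW; rewrite -(eqP (Hs _ _)) !permKV //.
  have := iota_ltn_sorted 0 c; rewrite -val_enum_ord sorted_map; exact: sub_sorted.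
have -> : sort leq u = t.
  apply: (sorted_eq leq_trans anti_leq); rewrite ?sort_sorted //.
    exact: leq_total.
  by rewrite perm_sort perm_sym.
rewrite -map_comp -[LHS](@take_size _ u) -(map_nth_iota0 0) // szu -val_enum_ord.
rewrite -map_comp; apply: eq_map => i /=.
by rewrite (nth_map (s i)) ?size_enum_ord // nth_ord_enum permK.
Qed.

Lemma one_line3 (s : 'S_3) (i0 := Ordinal (isT : 0 < 3))
    (i1 := Ordinal (isT : 1 < 3)) (i2 := Ordinal (isT : 2 < 3)) :
  one_line s = [:: (s i0).+1; (s i1).+1; (s i2).+1].
Proof.
rewrite /one_line; have -> : enum 'I_3 = [:: i0; i1; i2].
  by apply: (inj_map val_inj); rewrite val_enum_ord.
by [].
Qed.

(** The three patterns of the only part with more than one element. *)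
Definition K_patterns := [:: [:: 1; 2; 3]; [:: 1; 3; 2]; [:: 2; 3; 1]].

(** Since [u] and [v] have the same letters, each is determined by its order
    permutation; so a singleton part only gives [u = v]. *)
Lemma same_part_weq u v : perm_eq u v -> same_part K_123_132_231 u v -> weq u v.
Proof.
move=> p /exists_inP[P PK /andP[/exists_inP[s sP us] /exists_inP[t tP vt]]].
have uE := order_perm_sort us; have vE := order_perm_sort vt.
have sE := perm_sortP leq_total leq_trans anti_leq _ _ p.
rewrite -sE in vE.
move: PK; rewrite inE => /orP[/set1P PE|/imsetP[x _ PE]]; last first.
  move: sP tP; rewrite PE !inE => /eqP sx /eqP tx.
  by rewrite uE vE sx tx; exact: weq_refl.
move: sP tP; rewrite PE !inE.
case/and3P: us => /eqP szu Uu _.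
have /= : size (sort leq u) = 3 by rewrite size_sort.
have: sorted ltn (sort leq u).
  by rewrite ltn_sorted_uniq_leq sort_uniq Uu sort_sorted //; exact: leq_total.
move: uE vE; case: (sort leq u) => [|x [|y [|z []]]] //= uE vE.
case/and3P=> xy yz _ _ sw tw.
have H132 : weq [:: x; y; z] [:: x; z; y] by exact: (@weq_132 [::] [::]).
have H231 : weq [:: x; y; z] [:: y; z; x] by exact: (@weq_231 [::] [::]).
have to w (w' := [seq nth 0 [:: x; y; z] j.-1 | j <- w]) :
    [|| w == [:: 1; 2; 3], w == [:: 1; 3; 2] | w == [:: 2; 3; 1]] ->
    weq [:: x; y; z] w'.
  by case/or3P=> /eqP wE; rewrite /w' wE //; exact: weq_refl.
rewrite uE vE; exact: weq_trans (weq_sym (to _ sw)) (to _ tw).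
Qed.

Lemma weq_same_part x y z u : x < y -> y < z ->
  (u = [:: x; z; y] \/ u = [:: y; z; x]) ->
  same_part K_123_132_231 [:: x; y; z] u.
Proof.
move=> xy yz ueq; apply/exists_inP.
exists [set s : 'S_3 | one_line s \in K_patterns].
  by rewrite !inE eqxx.
have H w : w \in [:: [:: x; y; z]; [:: x; z; y]; [:: y; z; x]] ->
    [exists s in [set s : 'S_3 | one_line s \in K_patterns], is_order_perm w s].
  move=> wE; have [] := @order_perm_exists 3 w.
  - by move: wE; rewrite !inE => /or3P[] /eqP->.
  - by move: wE; rewrite !inE => /or3P[] /eqP-> /=; rewrite !inE; lia.
  move=> s ws; apply/exists_inP; exists s => //.
  case/and3P: ws => _ _ /'forall_forallP Hs.
  rewrite inE one_line3.
  set i0 := Ordinal _; set i1 := Ordinal _; set i2 := Ordinal _.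
  have lt i j := eqP (Hs i j).
  have := (lt i0 i1, lt i1 i2, lt i0 i2, lt i2 i0, lt i2 i1).
  have := (ltn_ord (s i0), ltn_ord (s i1), ltn_ord (s i2)).
  move: (nat_of_ord (s i0)) (nat_of_ord (s i1)) (nat_of_ord (s i2)) => p q r.
  rewrite /K_patterns !inE !eqseq_cons !eqSS eqxx !andbT.
  by move: wE; rewrite !inE => /or3P[] /eqP-> /= [[p3 q3] r3] [[[[]]]]; lia.
apply/andP; split; apply: H; first by rewrite !inE eqxx.
by case: ueq => ->; rewrite !inE eqxx ?orbT.
Qed.

(** Each word equivalent to a one-line word is itself one, so passing through
    arbitrary words does not enlarge the equivalence on permutations. *)
Lemma K_equiv_weq n (phi psi : 'S_n) :
  K_equiv K_123_132_231 phi psi <-> weq (one_line phi) (one_line psi).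
Proof.
split=> [/connectP[p pp ->]|].
  elim: p phi pp => [|q p IH] phi /=; first by move=> _; exact: weq_refl.
  case/andP=> /replacementP[a [u [v [b [e1 e2 uv]]]]] /IH.
  apply: weq_trans; rewrite e1 e2; apply/weq_cat/same_part_weq => //.
  rewrite -(perm_cat2l a) -(perm_cat2r b) -!catA -e1 -e2.
  by rewrite (permPl (perm_one_line _)) perm_sym perm_one_line.
move: {-1}(one_line phi) {-1}(one_line psi) (erefl (one_line phi))
  (erefl (one_line psi)) => v w pv pw vw.
have one_line_inj : injective (@one_line n).
  move=> s t /eq_in_map e; apply/permP=> i; apply/val_inj/succn_inj/e.
  by rewrite mem_enum.
elim: vw phi psi pv pw => {v w} [w|v w vw IH|u v w uv IHu vw IHv
  |a b x y z xy yz|a b x y z xy yz] phi psi e1 e2.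
- by rewrite (one_line_inj phi psi) ?e1 ?e2 //; exact: connect0.
- by rewrite /K_equiv (sym_connect_sym (replacement_sym _)); exact: IH.
- have [|r rv] := @one_line_surj n v.
    by rewrite -(permPl (weq_perm uv)) -e1 perm_one_line.
  exact: connect_trans (IHu _ _ e1 rv) (IHv _ _ rv e2).
- apply/connect1/replacementP; do 4 eexists; split; [exact: e1|exact: e2|].
  by apply: weq_same_part => //; left.
- apply/connect1/replacementP; do 4 eexists; split; [exact: e1|exact: e2|].
  by apply: weq_same_part => //; right.
Qed.

Theorem proposition2p15 (n : nat) (n_ge3 : 3 <= n) :
  #|K_classes n K_123_132_231| = 2 ^ (n - 1).
Proof.
case: n n_ge3 => // m _; rewrite subn1 /=.
pose f (s : 'S_m.+1) : m.-tuple bool :=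
  Tuple (introT eqP (size_code m 1 (one_line s))).
have fP s t : K_equiv K_123_132_231 s t = (f s == f t).
  have [ps pt] := (perm_one_line s, perm_one_line t).
  apply/idP/eqP => [/K_equiv_weq/(weq_code ps) e|[e]]; first exact: val_inj.
  exact/K_equiv_weq/(code_weq ps pt).
have f_surj c : exists s, f s = c.
  have [w pw wc] := code_surj 1 (size_tuple c).
  have [s sw] := one_line_surj pw.
  by exists s; apply: val_inj; rewrite /= sw.
(* The classes are the fibres of [f], one for each code. *)
pose g c := [set t | c == f t].
have -> : K_classes m.+1 K_123_132_231 = g @: [set: m.-tuple bool].
  apply/setP=> A; apply/imsetP/imsetP => [[s _ ->]|[c _ ->]].
    by exists (f s); rewrite ?inE //; apply/setP=> t; rewrite !inE fP.
  have [s <-] := f_surj c.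
  by exists s; rewrite ?inE //; apply/setP=> t; rewrite !inE fP.
rewrite card_imset ?cardsT ?card_tuple ?card_bool // => c d /setP.
have [s <-] := f_surj c; move/(_ s); rewrite !inE eqxx.
by move/esym/eqP.
Qed.
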